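(* Let $s\ge 2$ be an even integer. Then the polynomial $$\tilde Q_{s+1}(x)=\frac{s+1}{2^{s}}\left(\frac{T_{s+1}(x)}{s+1}-\frac{T_{s-1}(x)}{s-1}+\frac{2x}{s^2-1}\right)$$ has $s+1$ zeros $(c_i)_{i=0}^s$ on the interval $[-1,1]$, with $-1=c_0<c_1<\dots<c_s=1$.
   Context: $T_n$ denotes the Chebyshev polynomial of the first kind of degree $n$, i.e. $T_n(\cos\theta)=\cos(n\theta)$. *)

(* Defs.v *)
From HB Require Import structures.
From mathcomp Require Import all_boot all_order all_algebra.
From mathcomp Require Import all_classical all_reals all_analysis.
From mathcomp Require Import ring lra.

Set Implicit Arguments.
Unset Strict Implicit.
Unset Printing Implicit Defensive.

Import Order.TTheory GRing.Theory Num.Theory.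

Local Open Scope classical_set_scope.
Local Open Scope ring_scope.

Definition chebyshev_spec (R : realType) (n : nat) (p : {poly R}) : Prop :=
  forall t : R, p.[cos t] = cos (n%:R * t).

(* The default value 0 is never used: see [chebyshevT_cos] for existence and
   [chebyshevT_unique] for uniqueness. *)
Definition chebyshevT (R : realType) (n : nat) : {poly R} :=
  xget 0 [set p : {poly R} | chebyshev_spec n p].

(* Index shift: [Qtilde R s] has degree s + 1. *)
Definition Qtilde (R : realType) (s : nat) : {poly R} :=
  (s.+1%:R / 2 ^+ s) *:
    (s.+1%:R^-1 *: chebyshevT R s.+1 - s.-1%:R^-1 *: chebyshevT R s.-1
     + (2 / (s%:R ^+ 2 - 1)) *: 'X).

Section ChebyshevFacts.
Variable R : realType.
Implicit Types (n : nat) (p q : {poly R}) (t : R).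

Lemma chebyshev_spec0 : chebyshev_spec 0 (1 : {poly R}).
Proof. by move=> t; rewrite hornerE mul0r cos0. Qed.

Lemma chebyshev_spec1 : chebyshev_spec 1 ('X : {poly R}).
Proof. by move=> t; rewrite hornerX mul1r. Qed.

Lemma chebyshev_specSS n p q :
  chebyshev_spec n p -> chebyshev_spec n.+1 q ->
  chebyshev_spec n.+2 (2 *: ('X * q) - p).
Proof.
move=> hp hq t; rewrite hornerD hornerN hornerZ hornerM hornerX hp hq.
have -> : n.+2%:R * t = n.+1%:R * t + t by rewrite -[n.+2]addn1 natrD; ring.
have -> : n%:R * t = n.+1%:R * t - t by rewrite -(addn1 n) natrD; ring.
rewrite cosB cosD. ring.
Qed.

Lemma chebyshev_spec_ex n : exists p : {poly R}, chebyshev_spec n p.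
Proof.
suff [//] : (exists p : {poly R}, chebyshev_spec n p) /\
  (exists p : {poly R}, chebyshev_spec n.+1 p).
elim: n => [|n [[p hp] [q hq]]].
  by split; [exists 1; exact: chebyshev_spec0 | exists 'X; exact: chebyshev_spec1].
by split; [exists q | exists (2 *: ('X * q) - p); exact: chebyshev_specSS].
Qed.

Lemma chebyshevT_cos n t : (chebyshevT R n).[cos t] = cos (n%:R * t).
Proof.
by rewrite /chebyshevT; case: xgetP => [p _ //|no]; have [p /no] := chebyshev_spec_ex n.
Qed.

Lemma chebyshev_spec_inj n p q :
  chebyshev_spec n p -> chebyshev_spec n q -> p = q.
Proof.
move=> hp hq; apply/eqP; rewrite -subr_eq0; apply/negPn/negP => pq0.
pose rs : seq R := [seq i.+1%:R^-1 | i <- iota 0 (size (p - q))].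
have urs : uniq rs.
  rewrite map_inj_uniq ?iota_uniq // => i j /invr_inj /eqP.
  by rewrite eqr_nat eqSS => /eqP.
have ars : all (root (p - q)) rs.
  apply/allP => x /mapP[i _ ->].
  rewrite -[i.+1%:R^-1]acosK ?rootE.
    by rewrite hornerD hornerN hp hq subrr.
  rewrite in_itv /=; apply/andP; split.
    by apply: (@le_trans _ _ 0); rewrite ?oppr_le0 ?invr_ge0.
  by rewrite invf_le1 ?ltr0Sn // ler1n.
by have := max_poly_roots pq0 ars urs; rewrite size_map size_iota ltnn.
Qed.

Lemma chebyshevT_unique n p : chebyshev_spec n p -> p = chebyshevT R n.
Proof. by move=> hp; apply: (chebyshev_spec_inj hp) => t; exact: chebyshevT_cos. Qed.

Lemma chebyshevT0 : chebyshevT R 0 = 1.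
Proof. exact/esym/chebyshevT_unique/chebyshev_spec0. Qed.

Lemma chebyshevT1 : chebyshevT R 1 = 'X.
Proof. exact/esym/chebyshevT_unique/chebyshev_spec1. Qed.

Lemma chebyshevTSS n :
  chebyshevT R n.+2 = 2 *: ('X * chebyshevT R n.+1) - chebyshevT R n.
Proof.
by apply/esym/chebyshevT_unique/chebyshev_specSS => t; exact: chebyshevT_cos.
Qed.

Lemma size_chebyshevT n : size (chebyshevT R n) = n.+1.
Proof.
suff [//] : size (chebyshevT R n) = n.+1 /\ size (chebyshevT R n.+1) = n.+2.
elim: n => [|n [h1 h2]]; first by rewrite chebyshevT0 chebyshevT1 size_poly1 size_polyX.
split=> //; rewrite chebyshevTSS.
have T0 : chebyshevT R n.+1 != 0 by rewrite -size_poly_gt0 h2.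
have hs : size (2 *: ('X * chebyshevT R n.+1)) = n.+3.
  by rewrite size_scale ?pnatr_eq0 // mulrC size_mulX // h2.
by rewrite size_polyDl // hs size_polyN h1.
Qed.

End ChebyshevFacts.

(* Main.v *)
Require Import Defs.
From mathcomp Require Import all_boot all_order all_algebra.
From mathcomp Require Import all_classical all_reals all_analysis.
From mathcomp Require Import ring lra zify.

Import Order.TTheory GRing.Theory Num.Theory.
Local Open Scope ring_scope.

(** Write [s = 2 m].  The key fact is that half of the zeros are explicit, and
    that they force the other half.

    At the [m + 1] points [y = cos (j pi / m)] with [0 <= j <= m], which include
    both end points [-1] and [1], [T_s y = 1] and [T_(s+1) y = T_(s-1) y = y].
    The coefficients of [Qtilde] are such that it then vanishes at [y]
    ([Qtilde_root]).  Moreover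
    [(T_(s+1) / (s+1) - T_(s-1) / (s-1))' = 2 T_s], so up to a positive factor
    the derivative of [Qtilde] is [T_s + 1 / (s^2 - 1)], which is positive at
    every such [y] ([deriv_Qtilde_gt0]).  A polynomial that crosses zero upwards
    at two points has to cross it downwards in between
    ([root_between_up_crossings]), so each of the [m] gaps between consecutive
    points contains a further zero.  This makes [(m + 1) + m = s + 1] distinct
    zeros, and there are no others because [Qtilde] is nonzero of degree at most
    [s + 1]. *)

(** Dividing out the two known roots turns the hypotheses on the derivative into
    opposite signs of the quotient at [a] and [b], so that the intermediate value
    theorem applies to the quotient and its zero is neither [a] nor [b]. *)
Lemma root_between_up_crossings (R : rcfType) (p : {poly R}) (a b : R) :
  a < b -> root p a -> root p b -> 0 < p^`().[a] -> 0 < p^`().[b] ->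
  exists2 z, a < z < b & root p z.
Proof.
move=> ab /factor_theorem[q ->].
rewrite rootM root_XsubC (gt_eqF ab) orbF => /factor_theorem[r ->].
rewrite !derivM !derivXsubC mulr1.
rewrite !hornerE !subrr !mulr0 addr0 add0r => da db.
have ra : r.[a] < 0 by nra.
have rb : 0 < r.[b] by nra.
have [|z /andP[az zb] rz] := @poly_ivt _ r a b (ltW ab).
  by rewrite (ltW ra) (ltW rb).
exists z; last by rewrite !rootM rz.
rewrite !lt_neqAle az zb !andbT; apply/andP; split; apply/eqP => E.
  by move: ra; rewrite E (rootP rz) ltxx.
by move: rb; rewrite -E (rootP rz) ltxx.
Qed.

(** For [x = cos t] this is [n] times the addition formula
    [sin t * sin (n t) = cos t * cos (n t) - cos ((n + 1) t)]; as an identity of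
    polynomials it follows from the three-term recurrence by induction. *)
Lemma deriv_chebyshevT (R : realType) (n : nat) :
  (1 - 'X ^+ 2) * (chebyshevT R n)^`() =
    n%:R * ('X * chebyshevT R n - chebyshevT R n.+1).
Proof.
suff [//] : (1 - 'X ^+ 2) * (chebyshevT R n)^`() =
    n%:R * ('X * chebyshevT R n - chebyshevT R n.+1) /\
  (1 - 'X ^+ 2) * (chebyshevT R n.+1)^`() =
    n.+1%:R * ('X * chebyshevT R n.+1 - chebyshevT R n.+2).
elim: n => [|n [IH0 IH1]].
  rewrite chebyshevTSS chebyshevT1 chebyshevT0 derivX -polyC1 derivC -mul_polyC.
  by split; ring.
split => //; move: IH0 IH1.
rewrite (chebyshevTSS R n.+1) !(chebyshevTSS R n).
set T := chebyshevT R n; set T' := chebyshevT R n.+1 => IH0 IH1.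
rewrite derivB derivZ derivM derivX -!mul_polyC mul1r in IH0 IH1 *.
(* Group the factors so that both induction hypotheses can be substituted. *)
have -> : (1 - 'X ^+ 2) * (2%:P * (T' + 'X * T'^`()) - T^`()) =
  2%:P * ((1 - 'X ^+ 2) * T' + 'X * ((1 - 'X ^+ 2) * T'^`()))
  - (1 - 'X ^+ 2) * T^`() by ring.
rewrite {}IH0 {}IH1 polyCMn polyC1 -!natr1; ring.
Qed.

(** After multiplication by [1 - X^2], [deriv_chebyshevT] cancels the
    coefficients [1 / (n + 2)] and [1 / n], and the left side becomes
    [X T_(n+2) - T_(n+3) - X T_n + T_(n+1)]; the recurrence reduces this to
    [2 (1 - X^2) T_(n+1)]. *)
Lemma deriv_chebyshevT_diff (R : realType) (n : nat) : (0 < n)%N ->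
  (n.+2%:R^-1 *: chebyshevT R n.+2 - n%:R^-1 *: chebyshevT R n)^`() =
    2 *: chebyshevT R n.+1.
Proof.
move=> n0.
have X2 : (1 - 'X ^+ 2 : {poly R}) != 0.
  apply: contra_neq (oner_neq0 R) => /(congr1 (horner^~ 0)).
  by rewrite !hornerE expr0n subr0.
apply: (mulfI X2); rewrite derivB !derivZ mulrBr -!scalerAr !deriv_chebyshevT.
rewrite -!polyC_natr !mul_polyC !scalerA !mulVf ?pnatr_eq0 -?lt0n // !scale1r.
by rewrite !chebyshevTSS -!mul_polyC polyCMn polyC1; ring.
Qed.

Lemma deriv_Qtilde (R : realType) (s : nat) : (1 < s)%N ->
  (Qtilde R s)^`() =
    (s.+1%:R / 2 ^+ s * 2) *: (chebyshevT R s + (s%:R ^+ 2 - 1)^-1%:P).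
Proof.
case: s => [|[|n]] // _.
rewrite /Qtilde derivZ derivD deriv_chebyshevT_diff // derivZ derivX.
by rewrite -scalerA !scalerDr alg_polyC polyCM mul_polyC.
Qed.

Lemma sqr_natr_sub1_gt0 (R : realType) (s : nat) :
  (1 < s)%N -> 0 < (s%:R ^+ 2 - 1 : R).
Proof. by move=> s1; rewrite subr_gt0 exprn_egt1 ?ltr1n. Qed.

(** As [cos (s t) = 1] forces [sin (s t) = 0], the addition formulas give
    [cos ((s + 1) t) = cos ((s - 1) t) = cos t]; what remains is
    [1 / (s + 1) - 1 / (s - 1) + 2 / (s^2 - 1) = 0]. *)
Lemma Qtilde_root (R : realType) (s : nat) (t : R) : (1 < s)%N ->
  cos (s%:R * t) = 1 -> root (Qtilde R s) (cos t).
Proof.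
move=> s1 cst; have s0 : 0 < s%:R - 1 :> R by rewrite subr_gt0 ltr1n.
have sst : sin (s%:R * t) = 0.
  by have /eqP := cos2Dsin2 (s%:R * t); rewrite cst expr1n addrC -subr_eq0 addrK
    sqrf_eq0 => /eqP.
have pred_s : s.-1%:R = s%:R - 1 :> R by rewrite -subn1 natrB // ltnW.
apply/rootP; rewrite /Qtilde !(hornerZ, hornerD, hornerN, hornerX) !chebyshevT_cos.
have -> : cos (s.+1%:R * t) = cos t.
  by rewrite -natr1 mulrDl mul1r cosD cst sst mul1r mul0r subr0.
have -> : cos (s.-1%:R * t) = cos t.
  by rewrite pred_s mulrBl mul1r cosB cst sst mul1r mul0r addr0.
rewrite pred_s -natr1; have s2 : 0 < s%:R ^+ 2 - 1 :> R by apply: sqr_natr_sub1_gt0.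
have s3 : 0 < s%:R + 1 :> R by lra.
by field; rewrite ?gt_eqF ?exprn_gt0.
Qed.

Lemma deriv_Qtilde_gt0 (R : realType) (s : nat) (t : R) : (1 < s)%N ->
  cos (s%:R * t) = 1 -> 0 < (Qtilde R s)^`().[cos t].
Proof.
move=> s1 cst; rewrite deriv_Qtilde // hornerZ hornerD hornerC chebyshevT_cos cst.
by rewrite mulr_gt0 ?addr_gt0 ?invr_gt0 ?sqr_natr_sub1_gt0 ?mulr_gt0 ?invr_gt0
  ?exprn_gt0.
Qed.

Lemma size_Qtilde (R : realType) (s : nat) : (size (Qtilde R s) <= s.+2)%N.
Proof.
apply: leq_trans (size_scale_leq _ _) _.
apply: leq_trans (size_polyD _ _) _; rewrite geq_max.
apply/andP; split.
  apply: leq_trans (size_polyD _ _) _; rewrite geq_max size_polyN.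
  by apply/andP; split; apply: leq_trans (size_scale_leq _ _) _;
    rewrite size_chebyshevT // ltnS; lia.
by apply: leq_trans (size_scale_leq _ _) _; rewrite size_polyX.
Qed.

(** The zeros of [Qtilde] at which it increases, for [s = 2 m]; the angle uses
    [m - j] because the cosine decreases on [[0, pi]]. *)
Definition crossing (R : realType) (m j : nat) : R :=
  cos ((m - j)%:R * pi / m%:R).

Lemma crossing_angle (R : realType) (m j : nat) : (0 < m)%N ->
  cos (m.*2%:R * ((m - j)%:R * pi / m%:R)) = 1 :> R.
Proof.
move=> m0; have mn0 : m%:R != 0 :> R by rewrite pnatr_eq0 -lt0n.
have -> : m.*2%:R * ((m - j)%:R * pi / m%:R) = 0 + pi *+ 2 *+ (m - j) :> R.
  by rewrite -muln2 natrM -mulr_natr -(mulr_natr pi); field.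
by rewrite (periodicn (@cosD2pi R)) cos0.
Qed.

Lemma crossing_lt (R : realType) (m j : nat) :
  (j < m)%N -> crossing R m j < crossing R m j.+1.
Proof.
move=> jm; have m0 : 0 < m%:R :> R by rewrite ltr0n; lia.
have in0pi k : (m - k)%:R * pi / m%:R \in `[0, (pi : R)].
  rewrite in_itv /= divr_ge0 ?mulr_ge0 ?pi_ge0 //=.
  by rewrite ler_pdivrMr // mulrC ler_wpM2l ?pi_ge0 // ler_nat leq_subr.
rewrite /crossing ltr_cos //.
by rewrite ltr_pM2r ?invr_gt0 // ltr_pM2r ?pi_gt0 // ltr_nat; lia.
Qed.

Lemma crossing0 (R : realType) (m : nat) : (0 < m)%N -> crossing R m 0 = -1.
Proof.
by move=> m0; rewrite /crossing subn0 mulrC mulKf ?cospi // pnatr_eq0 -lt0n.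
Qed.

Lemma crossing_max (R : realType) (m : nat) : crossing R m m = 1.
Proof. by rewrite /crossing subnn !mul0r cos0. Qed.

Theorem theorem3p5 (R : realType) (s : nat) (hs : (2 <= s)%N) (hev : ~~ odd s) :
  exists c : 'I_s.+1 -> R,
    [/\ c ord0 = -1,
        c ord_max = 1,
        (forall i j : 'I_s.+1, (i < j)%N -> c i < c j) &
        (forall x : R, -1 <= x <= 1 ->
           (root (Qtilde R s) x <-> exists i : 'I_s.+1, x = c i))].
Proof.
pose m := s./2; have sE : s = m.*2 by rewrite even_halfK.
have m0 : (0 < m)%N by lia.
have cross_root j : root (Qtilde R s) (crossing R m j).
  by apply: Qtilde_root; rewrite // {1}sE crossing_angle.
have cross_up j : 0 < (Qtilde R s)^`().[crossing R m j].
  by apply: deriv_Qtilde_gt0; rewrite // {1}sE crossing_angle.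
have /choice[z zP] : forall j, exists z : R, (j < m)%N ->
    (crossing R m j < z < crossing R m j.+1) /\ root (Qtilde R s) z.
  move=> j; have [jm|] := ltnP j m; last by exists 0.
  have [z zI zr] := root_between_up_crossings _ _ _ _ (crossing_lt R m j jm)
    (cross_root j) (cross_root j.+1) (cross_up j) (cross_up j.+1).
  by exists z.
(* Explicit zeros at even indices, the zeros that they force at odd ones. *)
pose c i := if odd i then z i./2 else crossing R m i./2.
have c_root i : (i < s.+1)%N -> root (Qtilde R s) (c i).
  rewrite /c; case: ifP => // oi lis.
  by have [|_ ->] := zP i./2; first by lia.
have c_step i : (i < s)%N -> c i < c i.+1.
  move=> lis; have [|/andP[lz rz] _] := zP i./2; first by lia.
  rewrite /c /= uphalf_half; case: ifP => oi /=; first by rewrite add1n.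
  by rewrite add0n.
have c_lt i j : (i < j)%N -> (j < s.+1)%N -> c i < c j.
  move=> ij js.
  apply: (@homo_ltn_in _ [pred k | (k <= s)%N] c (fun x y => x < y)) => //=.
  - exact: lt_trans.
  - by move=> a b; rewrite !inE => la lb k kI; rewrite inE; lia.
  - by move=> k; rewrite !inE => _ /c_step.
  by rewrite inE; lia.
exists (fun i => c i); split.
- by rewrite /c /= crossing0.
- by rewrite /c /= (negPf hev) crossing_max.
- by move=> i j ij; apply: c_lt.
move=> x _; split=> [xr|[i ->]]; last exact: c_root.
(* A further zero [x] would make [s + 2] zeros, more than the degree allows. *)
apply: contrapT => xNc.
have Q0 : Qtilde R s != 0.
  by apply: contraTneq (cross_up 0%N) => ->; rewrite deriv0 horner0 ltxx.
pose zs := x :: [seq c i | i : 'I_s.+1].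
have zs_root : all (root (Qtilde R s)) zs.
  by rewrite /= xr; apply/allP => _ /mapP[i _ ->]; apply: c_root.
have zs_uniq : uniq zs.
  rewrite /= map_inj_uniq ?enum_uniq ?andbT.
    by apply/mapP => -[i _ xi]; apply: xNc; exists i.
  move=> i j cij; apply: val_inj; case: (ltngtP i j) => // /c_lt lt.
    by have := lt (ltn_ord j); rewrite cij ltxx.
  by have := lt (ltn_ord i); rewrite cij ltxx.
have := leq_trans (max_poly_roots Q0 zs_root zs_uniq) (size_Qtilde R s).
by rewrite /= size_map size_enum_ord ltnn.
Qed.
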